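(* Let $(G_n)_{n\in\mathbb{N}}$ be an $\mathrm{FO}$-convergent sequence of finite graphs with a modeling limit $L$, and let $\xi(x)$ be a formula in the language of graphs with one free variable that is algebraic in $L$, with $\xi(L)\neq\emptyset$. Then there exist a sequence $(r_n)_{n\in\mathbb{N}}$ with $r_n\in V(G_n)$ and a vertex $r\in\xi(L)$ such that $(G_n,r_n)$ $\mathrm{FO}$-converges to $(L,r)$, i.e. $\lim_{n\to\infty}\langle\phi,(G_n,r_n)\rangle=\langle\phi,(L,r)\rangle$ for every first-order formula $\phi$ in the language of rooted graphs.
   Context: Graphs are first-order structures in the language with one binary (edge) relation. For a formula $\phi$ with $p$ free variables and a structure $G$, $\phi(G)=\{\mathbf{v}\in V(G)^p : G\models\phi(\mathbf{v})\}$. The Stone pairing of $\phi$ ($p\ge1$) with a finite graph $G$ is $\langle\phi,G\rangle=|\phi(G)|/|V(G)|^p$; for sentences it is $1$ if $G\models\phi$ and $0$ otherwise. A sequence of finite graphs is $\mathrm{FO}$-convergent if $(\langle\phi,G_n\rangle)$ converges for every formula $\phi$. A modeling is a graph $L$ whose vertex set is a standard Borel space with a probability measure $\nu$ such that every first-order definable set $\phi(L)\subseteq V(L)^p$ is measurable; $\langle\phi,L\rangle=\nu^{\otimes p}(\phi(L))$ (and $1$/$0$ for sentences). $L$ is a modeling limit of $(G_n)$ if $\lim_n\langle\phi,G_n\rangle=\langle\phi,L\rangle$ for all $\phi$. The language of rooted graphs adds a constant symbol $\mathrm{Root}$; $(G,r)$ is $G$ with $\mathrm{Root}$ interpreted as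 $r$, and Stone pairings with rooted structures are defined in the same way. A formula $\xi(x)$ is algebraic in $L$ if $\xi(L)$ is finite. *)

(* Defs.v *)
From HB Require Import structures.
From mathcomp Require Import all_boot all_order all_algebra.
From mathcomp Require Import all_classical all_reals all_analysis.
Set Implicit Arguments. Unset Strict Implicit. Unset Printing Implicit Defensive.
Import Order.TTheory GRing.Theory Num.Theory numFieldNormedType.Exports.
Local Open Scope classical_set_scope.
Local Open Scope ring_scope.

Inductive term : Type := TVar of nat | TRoot.

Inductive formula : Type :=
| FEq  of term & term
| FAdj of term & term
| FNot of formula
| FAnd of formula & formula
| FOr  of formula & formula
| FEx  of nat & formula
| FAll of nat & formula.

Definition term_rootless (t : term) : bool :=
  if t is TRoot then false else true.

Fixpoint rootless (f : formula) : bool :=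
  match f with
  | FEq t1 t2 | FAdj t1 t2 => term_rootless t1 && term_rootless t2
  | FNot g => rootless g
  | FAnd g h | FOr g h => rootless g && rootless h
  | FEx _ g | FAll _ g => rootless g
  end.

Definition term_fv (t : term) : seq nat :=
  if t is TVar i then [:: i] else [::].

Fixpoint fv (f : formula) : seq nat :=
  match f with
  | FEq t1 t2 | FAdj t1 t2 => term_fv t1 ++ term_fv t2
  | FNot g => fv g
  | FAnd g h | FOr g h => fv g ++ fv h
  | FEx i g | FAll i g => [seq j <- fv g | j != i]
  end.

Definition fv_lt (p : nat) (f : formula) : bool := all (fun i => i < p)%N (fv f).

Definition teval (V : Type) (r : option V) (a : nat -> option V) (t : term)
  : option V :=
  match t with TVar i => a i | TRoot => r end.

Definition upd (V : Type) (a : nat -> option V) (i : nat) (v : V) :=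
  fun j => if j == i then Some v else a j.

Fixpoint sat (V : Type) (E : V -> V -> Prop) (r : option V)
    (a : nat -> option V) (f : formula) : Prop :=
  match f with
  | FEq t1 t2 => match teval r a t1, teval r a t2 with
                 | Some x, Some y => x = y | _, _ => False end
  | FAdj t1 t2 => match teval r a t1, teval r a t2 with
                  | Some x, Some y => E x y | _, _ => False end
  | FNot g => ~ sat E r a g
  | FAnd g h => sat E r a g /\ sat E r a h
  | FOr g h => sat E r a g \/ sat E r a h
  | FEx i g => exists v : V, sat E r (upd a i v) g
  | FAll i g => forall v : V, sat E r (upd a i v) g
  end.

Definition tassign (V : Type) (p : nat) (t : p.-tuple V) : nat -> option V :=
  onth t.

Definition defset (V : Type) (E : V -> V -> Prop) (r : option V) (p : nat)
  (f : formula) : set (p.-tuple V) := [set t | sat E r (tassign t) f].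
Arguments defset {V} E r p f.

Record fin_graph : Type := FGraph {
  fvert :> finType;
  fedge : rel fvert;
  fedge_sym : symmetric fedge;
  fedge_irr : irreflexive fedge;
  fvert_ne : (0 < #|fvert|)%N }.

(* Stone pairing <phi, G> (resp. <phi,(G,r)> when root = Some r),
   phi with free variables among x_0..x_(p-1):
   |phi(G)| / |V(G)|^p ; for p = 0 this is 1 if G |= phi and 0 otherwise. *)
Definition stone_fin (R : realType) (G : fin_graph) (root : option G) (p : nat)
    (f : formula) : R :=
  (#|[set t : p.-tuple G | `[< sat (fun x y => fedge x y) root (tassign t) f >] ]|%:R
    / (#|G|%:R ^+ p)).
Arguments stone_fin {R} G root p f.

(* nu^{(x) p}: the p-fold product of the probability P on p-tuples,
   defined by iterated integration over sections
   (nu^{(x) (p+1)}(A) = int nu^{(x) p}(A_x) dnu(x)). *)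
Fixpoint pow_measure (d : measure_display) (T : measurableType d) (R : realType)
    (P : probability T R) (p : nat) : set (p.-tuple T) -> \bar R :=
  match p with
  | 0 => fun A => (\1_A [tuple] : R)%:E
  | p'.+1 => fun A =>
      (\int[P]_x pow_measure P [set t : p'.-tuple T | A (cons_tuple x t)])%E
  end.

Definition stone_mod (d : measure_display) (T : measurableType d) (R : realType)
    (P : probability T R) (E : T -> T -> Prop) (root : option T) (p : nat)
    (f : formula) : \bar R :=
  pow_measure P (defset E root p f).

Definition borel_sets (X : topologicalType) : set (set X) :=
  smallest (sigma_algebra setT) (@open X).

Definition standard_borel (R : realType) (d : measure_display)
    (T : measurableType d) : Prop :=
  exists (X : completePseudoMetricType R),
    hausdorff_space X /\ (exists D : set X, countable D /\ dense D) /\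
    exists f : T -> X, bijective f /\
      (forall A : set T, measurable A -> borel_sets (f @` A)) /\
      (forall B : set X, borel_sets B -> measurable (f @^-1` B)).

Definition modeling (R : realType) (d : measure_display) (T : measurableType d)
    (P : probability T R) (E : T -> T -> Prop) : Prop :=
  [/\ standard_borel R T,
      (forall x y, E x y -> E y x),
      (forall x, ~ E x x) &
      (forall (p : nat) (f : formula), rootless f -> fv_lt p f ->
         measurable (defset E None p f))].

Definition FO_convergent (R : realType) (G : nat -> fin_graph) : Prop :=
  forall (p : nat) (f : formula), rootless f -> fv_lt p f ->
    exists l : R, (fun n => stone_fin (G n) None p f) @ \oo --> l.

Definition modeling_limit (R : realType) (G : nat -> fin_graph)
    (d : measure_display) (T : measurableType d) (P : probability T R)
    (E : T -> T -> Prop) : Prop :=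
  modeling P E /\
  forall (p : nat) (f : formula), rootless f -> fv_lt p f ->
    (fun n => (stone_fin (G n) None p f)%:E) @ \oo --> stone_mod P E None p f.

(* Main.v *)
(* Every root r in xi(L) works.  If xi has k solutions, the number of solutions v
   with f(v, y) is the sum over j <= k of the indicators of "at least j solutions
   v satisfy f(v, y)", so sum_(v in xi) <f, (G, v)> is a sum of k unrooted
   pairings and hence converges along G_n.  A product of two rooted pairings is the
   pairing of the conjunction on disjoint variables, so the same holds for sums
   over xi of any polynomial in the rooted pairings.  Given finitely many formulas
   f_i, apply this to h(v)^a with
     h(v) = 1 - (1/m) sum_i (<f_i, (G, v)> - <f_i, (L, r)>)^2:
   the limit is at least h(r)^a = 1, while if no v in xi(G_n) were e-close to r
   the sum would be at most k (1 - e^2/m)^a, which is small for large a.  A diagonal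
   choice over the countably many formulas then yields r_n. *)
Require Import Defs.
From HB Require Import structures.
From mathcomp Require Import all_boot all_order all_algebra.
From mathcomp Require Import all_classical all_reals all_analysis.
From mathcomp Require Import measurable_realfun lra.
Import Order.TTheory GRing.Theory Num.Theory numFieldNormedType.Exports.
Local Open Scope classical_set_scope.
Local Open Scope ring_scope.
Set Implicit Arguments. Unset Strict Implicit.

(** * Syntax *)

(** With [c := TRoot] this only moves variables; with [c] a variable outside the range of [rho] it
    eliminates the root constant. *)
Definition rename_term (rho : nat -> nat) (c t : term) : term :=
  if t is TVar i then TVar (rho i) else c.

(* Bound variables are renamed too, which makes substitution capture-free
   as soon as [rho] is injective and avoids [c]. *)
Fixpoint rename (rho : nat -> nat) (c : term) (f : formula) : formula :=
  match f with
  | FEq t1 t2 => FEq (rename_term rho c t1) (rename_term rho c t2)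
  | FAdj t1 t2 => FAdj (rename_term rho c t1) (rename_term rho c t2)
  | FNot g => FNot (rename rho c g)
  | FAnd g h => FAnd (rename rho c g) (rename rho c h)
  | FOr g h => FOr (rename rho c g) (rename rho c h)
  | FEx i g => FEx (rho i) (rename rho c g)
  | FAll i g => FAll (rho i) (rename rho c g)
  end.

Lemma teval_rename (V : Type) (r : option V) a rho c t :
  teval r a (rename_term rho c t) = teval (teval r a c) (a \o rho) t.
Proof. by case: t. Qed.

Lemma upd_rename (V : Type) (a : nat -> option V) (rho : nat -> nat) i v :
  injective rho -> upd a (rho i) v \o rho = upd (a \o rho) i v.
Proof. by move=> inj; apply: funext => j; rewrite /upd /= (inj_eq inj). Qed.

Lemma teval_upd (V : Type) (r : option V) a c k v :
  c <> TVar k -> teval r (upd a k v) c = teval r a c.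
Proof. by case: c => //= i neq; rewrite /upd; case: eqP => // eik; case: neq; rewrite eik. Qed.

(** Injectivity of [rho] makes an update at [rho i] correspond to an update at [i], and since [c]
    avoids the range of [rho], no quantifier changes the value of [c]. *)
Lemma sat_rename (V : Type) (E : V -> V -> Prop) (r : option V) rho c f a :
  injective rho -> (forall i, c <> TVar (rho i)) ->
  sat E r a (rename rho c f) <-> sat E (teval r a c) (a \o rho) f.
Proof.
move=> inj nc; elim: f a => [t1 t2|t1 t2|g IH|g IHg h IHh|g IHg h IHh|i g IH|i g IH] a //=.
- by rewrite !teval_rename.
- by rewrite !teval_rename.
- by rewrite IH.
- by rewrite IHg IHh.
- by rewrite IHg IHh.
- have step v : sat E r (upd a (rho i) v) (rename rho c g) <->
               sat E (teval r a c) (upd (a \o rho) i v) g.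
    by rewrite IH upd_rename// teval_upd.
  by split=> -[v] /step; exists v.
- have step v : sat E r (upd a (rho i) v) (rename rho c g) <->
               sat E (teval r a c) (upd (a \o rho) i v) g.
    by rewrite IH upd_rename// teval_upd.
  by split=> H v; apply/step.
Qed.

Lemma mem_term_fv_rename rho c t j : j \in term_fv (rename_term rho c t) ->
  j \in term_fv c \/ exists2 i, i \in term_fv t & j = rho i.
Proof.
case: t => [i|] /=; last by left.
by rewrite inE => /eqP ->; right; exists i => //; rewrite inE.
Qed.

Lemma mem_fv_rename rho c f j : j \in fv (rename rho c f) ->
  j \in term_fv c \/ exists2 i, i \in fv f & j = rho i.
Proof.
elim: f j => [t1 t2|t1 t2|g IH|g IHg h IHh|g IHg h IHh|i g IH|i g IH] j //=.
- rewrite mem_cat => /orP[] /mem_term_fv_rename[]; try by left.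
  + by move=> [i it ->]; right; exists i => //; rewrite mem_cat it.
  + by move=> [i it ->]; right; exists i => //; rewrite mem_cat it orbT.
- rewrite mem_cat => /orP[] /mem_term_fv_rename[]; try by left.
  + by move=> [i it ->]; right; exists i => //; rewrite mem_cat it.
  + by move=> [i it ->]; right; exists i => //; rewrite mem_cat it orbT.
- exact: IH.
- rewrite mem_cat => /orP[/IHg|/IHh] []; try by left.
  + by move=> [i it ->]; right; exists i => //; rewrite mem_cat it.
  + by move=> [i it ->]; right; exists i => //; rewrite mem_cat it orbT.
- rewrite mem_cat => /orP[/IHg|/IHh] []; try by left.
  + by move=> [i it ->]; right; exists i => //; rewrite mem_cat it.
  + by move=> [i it ->]; right; exists i => //; rewrite mem_cat it orbT.
- rewrite mem_filter => /andP[ji /IH[]]; first by left.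
  move=> [k kg jk]; right; exists k => //; rewrite mem_filter kg andbT.
  by apply: contra_neq ji => <-.
- rewrite mem_filter => /andP[ji /IH[]]; first by left.
  move=> [k kg jk]; right; exists k => //; rewrite mem_filter kg andbT.
  by apply: contra_neq ji => <-.
Qed.

Lemma rootless_rename_var rho i f : rootless (rename rho (TVar i) f).
Proof.
by elim: f => [[?|] [?|]|[?|] [?|]|g|g IHg h IHh|g IHg h IHh|? g|? g] //=;
  rewrite IHg IHh.
Qed.

Lemma rootless_rename rho c f : rootless f -> rootless (rename rho c f).
Proof.
elim: f => [[?|] [?|]|[?|] [?|]|g|g IHg h IHh|g IHg h IHh|? g|? g] //=;
  by move=> /andP[/IHg -> /IHh ->].
Qed.

Lemma sat_ext (V : Type) (E : V -> V -> Prop) (r : option V) f a b :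
  (forall i, i \in fv f -> a i = b i) -> sat E r a f <-> sat E r b f.
Proof.
have tE t a' b' : (forall i, i \in term_fv t -> a' i = b' i) ->
    teval r a' t = teval r b' t.
  by case: t => //= i; apply; rewrite inE.
elim: f a b => [t1 t2|t1 t2|g IH|g IHg h IHh|g IHg h IHh|i g IH|i g IH] a b /= ab.
- by rewrite (tE t1 a b) ?(tE t2 a b)// => i it; apply: ab; rewrite mem_cat it ?orbT.
- by rewrite (tE t1 a b) ?(tE t2 a b)// => i it; apply: ab; rewrite mem_cat it ?orbT.
- by rewrite (IH a b).
- by rewrite (IHg a b) ?(IHh a b)// => i it; apply: ab; rewrite mem_cat it ?orbT.
- by rewrite (IHg a b) ?(IHh a b)// => i it; apply: ab; rewrite mem_cat it ?orbT.
- have step v : sat E r (upd a i v) g <-> sat E r (upd b i v) g.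
    apply: IH => j jg; rewrite /upd; case: eqVneq => // ji.
    by apply: ab; rewrite mem_filter ji.
  by split=> -[v] /step; exists v.
- have step v : sat E r (upd a i v) g <-> sat E r (upd b i v) g.
    apply: IH => j jg; rewrite /upd; case: eqVneq => // ji.
    by apply: ab; rewrite mem_filter ji.
  by split=> H v; apply/step.
Qed.

Lemma sat_ext_lt (V : Type) (E : V -> V -> Prop) (r : option V) p f a b :
  fv_lt p f -> (forall i, (i < p)%N -> a i = b i) ->
  sat E r a f <-> sat E r b f.
Proof. by move=> /allP fp ab; apply: sat_ext => i /fp /ab. Qed.

(** The two conjuncts use disjoint blocks of variables and share only the root, so for a fixed root
    they are independent events on random tuples. *)
Definition indep_and (p : nat) (f g : formula) : formula :=
  FAnd f (rename (addn p) TRoot g).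

Lemma fv_lt_indep_and p q f g :
  fv_lt p f -> fv_lt q g -> fv_lt (p + q) (indep_and p f g).
Proof.
move=> /allP fp /allP gq; apply/allP => i; rewrite /= mem_cat => /orP[/fp|].
  by move=> /leq_trans; apply; rewrite leq_addr.
by move=> /mem_fv_rename[//|[j /gq jq ->]]; rewrite ltn_add2l.
Qed.

Lemma sat_indep_and (V : Type) (E : V -> V -> Prop) (r : option V) p f g (s : seq V) :
  fv_lt p f -> (p <= size s)%N ->
  sat E r (onth s) (indep_and p f g) <->
  sat E r (onth (take p s)) f /\ sat E r (onth (drop p s)) g.
Proof.
move=> fp ps; rewrite /= sat_rename//; last exact: (@addnI _).
have -> : onth s \o addn p = onth (drop p s).
  apply: funext => i /=; rewrite -{1}(cat_take_drop p s) onth_cat size_takel//.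
  by rewrite ltnNge leq_addr /= addKn.
rewrite (@sat_ext_lt _ _ _ p f _ (onth (take p s)))// => i ip.
by rewrite -{1}(cat_take_drop p s) onth_cat size_takel// ip.
Qed.

(** The root becomes coordinate 0, so a rooted definable set is a section of an unrooted one. *)
Definition unroot (f : formula) : formula := rename succn (TVar 0) f.

Lemma fv_lt_unroot p f : fv_lt p f -> fv_lt p.+1 (unroot f).
Proof.
move=> /allP fp; apply/allP => i /mem_fv_rename[|[j /fp jp ->//]].
by rewrite inE => /eqP ->.
Qed.

Lemma sat_unroot (V : Type) (E : V -> V -> Prop) (v : V) s f :
  sat E None (onth (v :: s)) (unroot f) <-> sat E (Some v) (onth s) f.
Proof. by apply: sat_rename => // i j []. Qed.

(** * Countability of the set of formulas *)

Definition tree_of_term (t : term) : GenTree.tree nat :=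
  GenTree.Leaf (if t is TVar i then i.+1 else 0%N).

Definition term_of_tree (t : GenTree.tree nat) : option term :=
  match t with
  | GenTree.Leaf 0 => Some TRoot
  | GenTree.Leaf i.+1 => Some (TVar i)
  | _ => None
  end.

Fixpoint tree_of_formula (f : formula) : GenTree.tree nat :=
  match f with
  | FEq s t => GenTree.Node 0 [:: tree_of_term s; tree_of_term t]
  | FAdj s t => GenTree.Node 1 [:: tree_of_term s; tree_of_term t]
  | FNot g => GenTree.Node 2 [:: tree_of_formula g]
  | FAnd g h => GenTree.Node 3 [:: tree_of_formula g; tree_of_formula h]
  | FOr g h => GenTree.Node 4 [:: tree_of_formula g; tree_of_formula h]
  | FEx i g => GenTree.Node 5 [:: GenTree.Leaf i; tree_of_formula g]
  | FAll i g => GenTree.Node 6 [:: GenTree.Leaf i; tree_of_formula g]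
  end.

Fixpoint formula_of_tree (t : GenTree.tree nat) : option formula :=
  match t with
  | GenTree.Node 0 [:: a; b] =>
    if (term_of_tree a, term_of_tree b) is (Some s, Some t) then Some (FEq s t) else None
  | GenTree.Node 1 [:: a; b] =>
    if (term_of_tree a, term_of_tree b) is (Some s, Some t) then Some (FAdj s t) else None
  | GenTree.Node 2 [:: a] => omap FNot (formula_of_tree a)
  | GenTree.Node 3 [:: a; b] =>
    if (formula_of_tree a, formula_of_tree b) is (Some g, Some h) then Some (FAnd g h) else None
  | GenTree.Node 4 [:: a; b] =>
    if (formula_of_tree a, formula_of_tree b) is (Some g, Some h) then Some (FOr g h) else None
  | GenTree.Node 5 [:: GenTree.Leaf i; a] => omap (FEx i) (formula_of_tree a)
  | GenTree.Node 6 [:: GenTree.Leaf i; a] => omap (FAll i) (formula_of_tree a)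
  | _ => None
  end.

(** Countability lets the final diagonal argument enumerate all pairs of an arity and a formula. *)
Lemma tree_of_formulaK : pcancel tree_of_formula formula_of_tree.
Proof.
by elim=> [[?|] [?|]|[?|] [?|]|g IH|g IHg h IHh|g IHg h IHh|i g IH|i g IH] //=;
  rewrite ?IH ?IHg ?IHh.
Qed.

HB.instance Definition _ := Countable.copy formula (pcan_type tree_of_formulaK).

(** * Counting the elements satisfying a formula *)

(* [atleast w j theta]: at least [j] elements [v] satisfy [theta] when the
   variable substituted into [theta] denotes [v]; variables from [w] on are used
   for the witnesses. *)
Fixpoint atleast (w j : nat) (theta : nat -> formula) : formula :=
  if j is j'.+1 then
    FEx w (FAnd (theta w)
      (atleast w.+1 j' (fun u => FAnd (theta u) (FNot (FEq (TVar u) (TVar w))))))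
  else FAll w (FEq (TVar w) (TVar w)).

(** The invariant lets [theta u] use only [u] and variables below [w]. It survives the recursion
    because the added inequality mentions only [u] and [w], and [w] lies below [w.+1]. *)
Lemma fv_lt_atleast w j theta :
  (forall u i, (w <= u)%N -> i \in fv (theta u) -> (i < w)%N || (i == u)) ->
  fv_lt w (atleast w j theta).
Proof.
elim: j w theta => [|j IH] w theta th; apply/allP => i /=.
  by rewrite eqxx.
rewrite mem_filter mem_cat => /andP[/negPf iw /orP[/(th _ _ (leqnn w))|]].
  by rewrite iw orbF.
have /IH/allP H : forall u i, (w < u)%N ->
   i \in fv (FAnd (theta u) (FNot (FEq (TVar u) (TVar w)))) -> (i < w.+1)%N || (i == u).
  move=> u k wu /=; rewrite mem_cat !inE => /or3P[/(th _ _ (ltnW wu))/orP[kw|->]|->|/eqP ->].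
  - by rewrite ltnS ltnW.
  - by rewrite orbT.
  - by rewrite orbT.
  - by rewrite ltnS leqnn.
by move=> /H; rewrite ltnS leq_eqVlt iw.
Qed.

Lemma rootless_atleast w j theta :
  (forall u, rootless (theta u)) -> rootless (atleast w j theta).
Proof.
elim: j w theta => //= j IH w theta th; rewrite th IH// => u.
by rewrite /= th.
Qed.

(** Once a witness [v] is chosen, the inequality added to [theta] cuts its solutions down to
    [rem v s], so the induction on [j] lowers both sides by one. The hypothesis ranges over all [b]
    agreeing with [a] below [w] because [theta] is evaluated after further witnesses have been
    assigned. *)
Lemma sat_atleast (V : choiceType) (E : V -> V -> Prop) (r : option V) w j theta
    (a : nat -> option V) (s : seq V) : uniq s ->
  (forall u b v, (w <= u)%N -> (forall i, (i < w)%N -> b i = a i) ->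
     b u = Some v -> sat E r b (theta u) <-> v \in s) ->
  sat E r a (atleast w j theta) <-> (j <= size s)%N.
Proof.
elim: j w theta a s => [|j IH] w theta a s us th /=.
  by split=> // _ v; rewrite /upd eqxx.
have step v : v \in s -> sat E r (upd a w v) (atleast w.+1 j
    (fun u => FAnd (theta u) (FNot (FEq (TVar u) (TVar w))))) <->
    (j <= (size s).-1)%N.
  move=> vs; rewrite -(size_rem vs); apply: IH; first exact: rem_uniq.
  move=> u b x wu ba bu /=; rewrite (th u b x); last 1 first.
  - exact: bu.
  - rewrite bu ba// /upd eqxx mem_rem_uniq// !inE.
    by split=> [[-> /eqP ->//]|/andP[/eqP]].
  - exact: ltnW.
  - by move=> i iw; rewrite ba ?ltnS ?(ltnW iw)// /upd (ltn_eqF iw).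
have thw v : sat E r (upd a w v) (theta w) <-> v \in s.
  apply: th => //; last by rewrite /upd eqxx.
  by move=> i iw; rewrite /upd (ltn_eqF iw).
split=> [[v [/thw vs /step]]|js].
  by move=> /(_ vs); case: (s) vs.
have [v vs] : exists v, v \in s.
  by case: (s) js => // v ? _; exists v; rewrite inE eqxx.
exists v; split; first exact/thw.
by apply/step => //; rewrite -ltnS prednK//; case: (s) vs.
Qed.

(** [addn u] takes variable 0 of [xi] to [u], and [bump u] skips [u], so [TVar u] can replace the
    root of [f] without capture. Witnesses start at [p], hence [bump u] fixes the free variables of
    [f] when these are below [p]. *)
Definition count_formula (xi : formula) (p j : nat) (f : formula) : formula :=
  atleast p j (fun u => FAnd (rename (addn u) TRoot xi) (rename (bump u) (TVar u) f)).

Lemma fv_lt_count xi p j f : fv_lt 1 xi -> fv_lt p f ->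
  fv_lt p (count_formula xi p j f).
Proof.
move=> /allP x1 /allP fp; apply: fv_lt_atleast => u i pu.
rewrite mem_cat => /orP[] /mem_fv_rename[//|].
- by move=> [k /x1]; rewrite ltnS leqn0 => /eqP -> ->; rewrite addn0 eqxx orbT.
- by rewrite inE => ->; rewrite orbT.
- move=> [k /fp kp ->]; rewrite /bump [(u <= _)%N]leqNgt (leq_trans kp pu) add0n.
  by rewrite kp.
Qed.

Lemma rootless_count xi p j f : rootless xi -> rootless (count_formula xi p j f).
Proof.
move=> rx; apply: rootless_atleast => u.
by rewrite /= rootless_rename// rootless_rename_var.
Qed.

Lemma sat_count (V : choiceType) (E : V -> V -> Prop) xi p j f (t : seq V)
    (s : seq V) :
  fv_lt 1 xi -> fv_lt p f -> uniq s ->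
  (forall x, x \in s <-> sat E None (upd (fun=> None) 0 x) xi) ->
  sat E None (onth t) (count_formula xi p j f) <->
  (j <= count (fun v => `[< sat E (Some v) (onth t) f >]) s)%N.
Proof.
move=> x1 fp us sP; rewrite -size_filter; apply: sat_atleast.
  exact: filter_uniq.
move=> u b v pu bt bu; rewrite mem_filter.
have ext1 : sat E None b (rename (addn u) TRoot xi) <-> v \in s.
  rewrite sat_rename//; last exact: (@addnI _).
  rewrite sP; apply: (@sat_ext_lt _ _ _ 1) => // i.
  by rewrite ltnS leqn0 => /eqP -> /=; rewrite addn0 bu.
have ext2 : sat E None b (rename (bump u) (TVar u) f) <-> sat E (Some v) (onth t) f.
  rewrite sat_rename; last 2 first.
  - exact: can_inj (@bumpK u).
  - by move=> i [] /eqP; rewrite (negPf (neq_bump _ _)).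
  rewrite /= bu; apply: (@sat_ext_lt _ _ _ p) => // i ip /=.
  by rewrite /bump [(u <= _)%N]leqNgt (leq_trans ip pu) add0n bt.
split=> [[/ext1 -> /ext2 ?]|/andP[/asboolP/ext2 ? /ext1 ?]//].
by rewrite andbT; apply/asboolP.
Qed.

(** * Pairings with a modeling *)

Definition cons_pair d (T : measurableType d) p (x : T * p.-tuple T) : p.+1.-tuple T :=
  cons_tuple x.1 x.2.

Lemma measurable_cons_pair d (T : measurableType d) p :
  measurable_fun setT (@cons_pair d T p).
Proof. exact: (measurable_cons measurable_fst measurable_snd). Qed.

HB.instance Definition _ d (T : measurableType d) p :=
  isMeasurableFun.Build _ _ _ _ (@cons_pair d T p) (@measurable_cons_pair d T p).

(** [pow_measure] is a bare set function; a probability measure with the same values gives access to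
    finiteness, bounds and integrals of indicators. *)
Fixpoint pow_probability d (T : measurableType d) (R : realType)
    (P : probability T R) (p : nat) : probability (p.-tuple T) R :=
  if p is p'.+1 then distribution (P \x pow_probability P p')%E (@cons_pair d T p')
  else \d_[tuple].

Lemma pow_probabilityE d (T : measurableType d) (R : realType)
    (P : probability T R) p (A : set (p.-tuple T)) :
  pow_probability P p A = pow_measure P A.
Proof.
elim: p A => [A|p IH A] /=; first by rewrite diracE indicE.
apply: eq_integral => x _ /=; rewrite -IH.
by congr (_ _); apply/seteqP; split => t; rewrite /xsection /= inE.
Qed.

(** Induction on [p] integrates out the first coordinate, and the factor of [B] is a constant that
    leaves the integral. Taking [A] and [B] on [seq T] avoids casts between tuple types. *)
Lemma pow_measure_take_drop d (T : measurableType d) (R : realType)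
    (P : probability T R) p q (A B : set (seq T)) :
  measurable [set t : p.-tuple T | A t] -> measurable [set t : q.-tuple T | B t] ->
  pow_measure P [set t : (p + q).-tuple T | A (take p t) /\ B (drop p t)] =
  (pow_measure P [set t : p.-tuple T | A t] * pow_measure P [set t : q.-tuple T | B t])%E.
Proof.
elim: p A => [|p IH] A mA mB.
  rewrite [X in (X * _)%E]/= indicE.
  have [A0|nA0] := pselect (A [::]).
    rewrite mem_set// mul1e; congr (pow_measure P _).
    by apply/seteqP; split=> t /=; rewrite take0 drop0; [case|].
  rewrite memNset// mul0e -(_ : pow_measure P (set0 : set (q.-tuple T)) = 0%E).
    by congr (pow_measure P _); apply/seteqP; split=> t //=; rewrite take0 => -[].
  by rewrite -pow_probabilityE measure0.
have mAx x : measurable [set t : p.-tuple T | A (x :: t)].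
  have : measurable_fun setT (fun t : p.-tuple T => [the p.+1.-tuple T of x :: t]).
    by apply: measurable_cons => //; exact: measurable_id.
  by move=> /(_ measurableT _ mA); rewrite setTI.
rewrite /= -ge0_integralZr//.
- by apply: eq_integral => x _; rewrite -(IH (fun s => A (x :: s))).
(* The integrand is measurable as the measure of the sections of the preimage of [A] under
   [cons_pair]. *)
- have := measurable_fun_xsection (pow_probability P p)
    (measurable_cons_pair measurableT mA).
  rewrite setTI; congr (measurable_fun _ _).
  apply: funext => x /=; rewrite pow_probabilityE; congr (pow_measure P _).
  by apply/seteqP; split => t; rewrite /xsection /= inE.
- by move=> x _; rewrite -pow_probabilityE.
- by rewrite -pow_probabilityE.
Qed.

(** Discrete layer-cake formula: a number [c <= k] equals the number of [j < k] with [j < c].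
    Allowing [k] above the size of [s] lets one [k] serve all large finite graphs as well as the
    limit. *)
Lemma sum_indicator_count (R : nzSemiRingType) (V : Type) (b : pred V) (s : seq V) k :
  (size s <= k)%N ->
  \sum_(v <- s) (b v)%:R = \sum_(j < k) ((j < count b s)%N)%:R :> R.
Proof.
move=> sk; have cs := leq_trans (count_size b s) sk.
rewrite -!natr_sum; congr (_%:R).
rewrite -big_mkcond /= sum1_count.
rewrite -(big_mkord xpredT (fun j => nat_of_bool (j < count b s)%N)).
rewrite (big_cat_nat (leq0n _) cs)/= addnC big_nat_cond big1 ?add0n; last first.
  by move=> j; rewrite andbT => /andP[cj _]; rewrite ltnNge cj.
rewrite big_nat_cond (eq_bigr (fun=> 1%N)).
  by rewrite -big_nat_cond sum_nat_const_nat subn0 muln1.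
by move=> j; rewrite andbT => /andP[_ ->].
Qed.

Section modeling_pairings.
Variables (d : measure_display) (T : measurableType d) (R : realType).
Variables (P : probability T R) (E : T -> T -> Prop).
Hypothesis mE : forall p f, rootless f -> fv_lt p f -> measurable (defset E None p f).

(** The set is the preimage of the one defined by [unroot f] under prefixing [v], and [mE] covers
    [unroot f] because it is rootless. *)
Lemma measurable_defset_root p f v : fv_lt p f -> measurable (defset E (Some v) p f).
Proof.
move=> fp; have : measurable_fun setT (fun t : p.-tuple T => [the p.+1.-tuple T of v :: t]).
  by apply: measurable_cons => //; exact: measurable_id.
move=> /(_ measurableT _ (@mE p.+1 (unroot f) (rootless_rename_var succn 0 f) (fv_lt_unroot fp))).
rewrite setTI; congr (measurable _); apply/seteqP; split=> t /=;
  by move/sat_unroot.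
Qed.

Lemma stone_mod_fin_num root p f : measurable (defset E root p f) ->
  stone_mod P E root p f \is a fin_num.
Proof. by move=> ?; rewrite /stone_mod -pow_probabilityE; exact: fin_num_measure. Qed.

Lemma stone_mod_itv root p f : measurable (defset E root p f) ->
  0 <= fine (stone_mod P E root p f) <= 1.
Proof.
move=> mf; rewrite fine_ge0/=; last by rewrite /stone_mod -pow_probabilityE.
rewrite -lee_fin fineK ?stone_mod_fin_num// /stone_mod -pow_probabilityE.
exact: probability_le1.
Qed.

Lemma stone_mod_indep_and v p q f g : fv_lt p f -> fv_lt q g ->
  fine (stone_mod P E (Some v) (p + q) (indep_and p f g)) =
  fine (stone_mod P E (Some v) p f) * fine (stone_mod P E (Some v) q g).
Proof.
move=> fp gq; rewrite -fineM ?stone_mod_fin_num//; try exact: measurable_defset_root.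
congr fine.
rewrite -(pow_measure_take_drop P (A := fun s => sat E (Some v) (onth s) f)
                        (B := fun s => sat E (Some v) (onth s) g)).
- congr (pow_measure P _); apply/seteqP; split=> t /=.
  + by move/(sat_indep_and _ _ _ fp); apply; rewrite size_tuple leq_addr.
  + by move=> H; apply/(sat_indep_and _ _ _ fp) => //; rewrite size_tuple leq_addr.
- exact: (measurable_defset_root v fp).
- exact: (measurable_defset_root v gq).
Qed.

(** Both sides are integrals over tuples [t] of finite sums of indicators, which agree at every [t]
    by [sum_indicator_count]; the successor in [j.+1] expresses [j < count] as having at least
    [j.+1] witnesses. *)
Lemma stone_mod_count xi p f s k : (size s <= k)%N -> rootless xi -> fv_lt 1 xi -> fv_lt p f -> uniq s ->
  (forall x, x \in s <-> sat E None (upd (fun=> None) 0 x) xi) ->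
  \sum_(v <- s) fine (stone_mod P E (Some v) p f) =
  \sum_(j < k) fine (stone_mod P E None p (count_formula xi p j.+1 f)).
Proof.
move=> sk rxi xi1 fp us sP; apply: EFin_inj; rewrite -!sumEFin.
have mj j : measurable (defset E None p (count_formula xi p j f)).
  by apply: mE; [exact: rootless_count|exact: fv_lt_count].
have mv v := measurable_defset_root v fp.
under eq_bigr do rewrite fineK ?stone_mod_fin_num// /stone_mod -pow_probabilityE
  -(setIT (defset _ _ _ _)) -integral_indic//.
under [RHS]eq_bigr do rewrite fineK ?stone_mod_fin_num// /stone_mod -pow_probabilityE
  -(setIT (defset _ _ _ _)) -integral_indic//.
rewrite -!ge0_integral_sum//; last 2 first.
- by move=> j; apply/measurable_EFinP; exact: measurable_indic.
- by move=> v; apply/measurable_EFinP; exact: measurable_indic.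
apply: eq_integral => t _; rewrite !sumEFin; congr EFin.
rewrite (eq_bigr (fun v => `[< sat E (Some v) (onth t) f >]%:R)).
  rewrite (sum_indicator_count _ _ sk); apply: eq_bigr => j _; rewrite indicE; congr (_%:R).
  by congr nat_of_bool; apply/idP/idP; rewrite inE => /(sat_count _ _ xi1 fp us sP).
by move=> v _; rewrite indicE; congr (nat_of_bool _)%:R; apply/idP/asboolP; rewrite inE.
Qed.
End modeling_pairings.

(** * Pairings with a finite graph *)

Section finite_pairings.
Variables (R : realType) (G : fin_graph).
Let edge (x y : G) : Prop := fedge x y.

Lemma stone_finE (root : option G) p f :
  stone_fin G root p f =
  (\sum_(t : p.-tuple G) `[< sat edge root (onth t) f >]%:R) / #|G|%:R ^+ p :> R.
Proof.
rewrite /stone_fin; congr (_ / _); rewrite -natr_sum; congr (_%:R).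
rewrite -sum1_card big_mkcond /=; apply: eq_bigr => t _.
by rewrite unfold_in asboolb; case: asboolP.
Qed.

Lemma card_fin_graph_gt0 : 0 < #|G|%:R :> R.
Proof. by rewrite ltr0n fvert_ne. Qed.

Lemma stone_fin_itv root p f : 0 <= (stone_fin G root p f : R) <= 1.
Proof.
rewrite /stone_fin divr_ge0 ?exprn_ge0 ?ler0n//= ler_pdivrMr ?exprn_gt0 ?card_fin_graph_gt0//.
by rewrite mul1r -natrX ler_nat -card_tuple max_card.
Qed.

Lemma sum_tuple0 (F : seq G -> R) : \sum_(t : 0.-tuple G) F t = F [::].
Proof.
rewrite (bigD1 [tuple])//= big1 ?addr0// => t.
by move=> /negP[]; rewrite (tuple0 t).
Qed.

Lemma stone_fin_sentence root f :
  stone_fin G root 0 f = `[< sat edge root (onth [::]) f >]%:R :> R.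
Proof.
by rewrite stone_finE expr0 divr1 (sum_tuple0 (fun s => `[< sat edge root (onth s) f >]%:R)).
Qed.

Lemma sum_tuple_cons p (F : seq G -> R) :
  \sum_(t : p.+1.-tuple G) F t = \sum_x \sum_(t : p.-tuple G) F (x :: t).
Proof.
rewrite pair_big /= (reindex (fun xt : G * p.-tuple G => cons_tuple xt.1 xt.2))//=.
exists (fun t => (thead t, behead_tuple t)) => [[x t]|t] _ /=.
  by congr pair; apply: val_inj.
by rewrite [RHS]tuple_eta; apply: val_inj.
Qed.

Lemma sum_tuple_take_drop p q (A B : seq G -> R) :
  \sum_(t : (p + q).-tuple G) A (take p t) * B (drop p t) =
  (\sum_(t : p.-tuple G) A t) * (\sum_(t : q.-tuple G) B t).
Proof.
elim: p A => [|p IH] A.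
  rewrite sum_tuple0.
  by rewrite mulr_sumr; apply: eq_bigr => t _; rewrite take0 drop0.
rewrite (@sum_tuple_cons (p + q) (fun s => A (take p.+1 s) * B (drop p.+1 s))).
rewrite sum_tuple_cons mulr_suml; apply: eq_bigr => x _.
exact: (IH (fun s => A (x :: s))).
Qed.

Lemma stone_fin_indep_and root p q f g : fv_lt p f -> fv_lt q g ->
  stone_fin G root (p + q) (indep_and p f g) =
  stone_fin G root p f * stone_fin G root q g :> R.
Proof.
move=> fp gq; rewrite !stone_finE mulrACA -invfM -exprD; congr (_ / _).
rewrite -(sum_tuple_take_drop p q (fun s => `[< sat edge root (onth s) f >]%:R)
  (fun s => `[< sat edge root (onth s) g >]%:R)).
apply: eq_bigr => t _; rewrite -natrM mulnb -asbool_and; congr (nat_of_bool _)%:R.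
apply: asbool_equiv_eq.
by apply: sat_indep_and => //; rewrite size_tuple leq_addr.
Qed.

(** Finite counterpart of [stone_mod_count]: exchanging sums replaces linearity of the integral. *)
Lemma stone_fin_count xi p f s k : (size s <= k)%N -> fv_lt 1 xi -> fv_lt p f -> uniq s ->
  (forall x, x \in s <-> sat edge None (upd (fun=> None) 0 x) xi) ->
  \sum_(v <- s) stone_fin G (Some v) p f =
  \sum_(j < k) stone_fin G None p (count_formula xi p j.+1 f) :> R.
Proof.
move=> sk xi1 fp us sP.
under eq_bigr do rewrite stone_finE.
under [RHS]eq_bigr do rewrite stone_finE.
rewrite -!mulr_suml; congr (_ / _); rewrite exchange_big [RHS]exchange_big.
apply: eq_bigr => t _; rewrite (sum_indicator_count _ _ sk); apply: eq_bigr => j _.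
by congr (nat_of_bool _)%:R; apply/idP/asboolP => /(sat_count _ _ xi1 fp us sP).
Qed.

End finite_pairings.

(** * Polynomials in the pairings *)

(** A true sentence: its pairing gives the constant monomial, and [count_formula] applied to it
    counts all solutions of [xi]. *)
Definition ftop : formula := FAll 0 (FEq (TVar 0) (TVar 0)).

(** These properties are all that the limit argument uses of rooted pairings, so finite graphs and
    modelings are treated alike. *)
Record is_pairing (R : realType) (val : nat -> formula -> R) : Prop := IsPairing {
  pairing_top : val 0 ftop = 1;
  pairing_itv : forall p f, fv_lt p f -> 0 <= val p f <= 1;
  pairing_mul : forall p q f g, fv_lt p f -> fv_lt q g ->
    val (p + q) (indep_and p f g) = val p f * val q g }.

(** Linear combinations of single pairings already express all polynomials, because [indep_and]
    turns a product of pairings into one pairing. The equations are imposed on [is_pairing] families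
    only, where that reduction is valid. *)
Inductive pairing_poly (R : realType) (h : (nat -> formula -> R) -> R) : Prop :=
| PPmonomial c p f of fv_lt p f & forall val, is_pairing val -> h val = c * val p f
| PPadd h1 h2 of pairing_poly h1 & pairing_poly h2 &
    forall val, is_pairing val -> h val = h1 val + h2 val.

Section pairing_poly.
Variable R : realType.
Implicit Types h : (nat -> formula -> R) -> R.

Lemma pairing_poly_cst c : pairing_poly (fun=> c : R).
Proof.
by apply: (@PPmonomial _ _ c 0 ftop) => // val /pairing_top ->; rewrite mulr1.
Qed.

Lemma pairing_poly_val p f : fv_lt p f -> pairing_poly (fun val : _ -> _ -> R => val p f).
Proof. by move=> fp; apply: (PPmonomial (c := 1) fp) => val _; rewrite mul1r. Qed.

Lemma pairing_polyD h1 h2 : pairing_poly h1 -> pairing_poly h2 ->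
  pairing_poly (fun val => h1 val + h2 val).
Proof. by move=> p1 p2; apply: (PPadd p1 p2). Qed.

Lemma pairing_polyM h1 h2 : pairing_poly h1 -> pairing_poly h2 ->
  pairing_poly (fun val => h1 val * h2 val).
Proof.
elim=> [{}h1 c p f fp h1E|{}h1 k1 k2 _ IH1 _ IH2 h1E] p2; last first.
  by apply: (PPadd (IH1 p2) (IH2 p2)) => val pv; rewrite h1E// mulrDl.
elim: p2 => [{}h2 c' q g gq h2E|{}h2 k1 k2 _ IH1 _ IH2 h2E]; last first.
  by apply: (PPadd IH1 IH2) => val pv; rewrite h2E// mulrDr.
apply: (PPmonomial (c := c * c') (fv_lt_indep_and fp gq)) => val pv.
by rewrite h1E// h2E// (pairing_mul pv fp gq) mulrACA.
Qed.

Lemma pairing_polyX h n : pairing_poly h -> pairing_poly (fun val => h val ^+ n).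
Proof.
move=> ph; elim: n => [|n IH]; first exact: pairing_poly_cst.
by under eq_fun do rewrite exprS; exact: pairing_polyM.
Qed.

Lemma pairing_poly_sum (I : eqType) (l : seq I) (H : I -> (nat -> formula -> R) -> R) :
  (forall i, i \in l -> pairing_poly (H i)) ->
  pairing_poly (fun val => \sum_(i <- l) H i val).
Proof.
elim: l => [|i l IH] Hl.
  by under eq_fun do rewrite big_nil; exact: pairing_poly_cst.
under eq_fun do rewrite big_cons; apply: pairing_polyD.
  by apply: Hl; rewrite inE eqxx.
by apply: IH => j jl; apply: Hl; rewrite inE jl orbT.
Qed.

End pairing_poly.

(** * Approximating a root of the limit on finitely many formulas *)

Section approximation.
Variables (R : realType) (V : nat -> Type) (W : eqType).
Variables (s : forall n, seq (V n)) (val : forall n, V n -> nat -> formula -> R).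
Variables (sL : seq W) (valL : W -> nat -> formula -> R).
Hypothesis pval : forall n v, is_pairing (@val n v).
Hypothesis pvalL : forall w, is_pairing (valL w).
Hypothesis cvg_val : forall p f, fv_lt p f ->
  (fun n => \sum_(v <- s n) val v p f) @ \oo --> \sum_(w <- sL) valL w p f.

(** A polynomial in pairings is a linear combination of pairings, so linearity of sums and limits
    reduces the claim to [cvg_val]. *)
Lemma cvg_pairing_poly h : pairing_poly h ->
  (fun n => \sum_(v <- s n) h (val v)) @ \oo --> \sum_(w <- sL) h (valL w).
Proof.
elim=> [{}h c p f fp hE|{}h h1 h2 _ IH1 _ IH2 hE].
  have sumE U (t : seq U) (u : U -> nat -> formula -> R) : (forall x, is_pairing (u x)) ->
      \sum_(x <- t) h (u x) = c * \sum_(x <- t) u x p f.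
    by move=> pu; rewrite mulr_sumr; apply: eq_bigr => x _; exact: hE.
  rewrite sumE// (eq_cvg _ _ (fun n => sumE _ (s n) _ (@pval n))).
  by apply: cvgMr; exact: cvg_val.
have sumE U (t : seq U) (u : U -> nat -> formula -> R) : (forall x, is_pairing (u x)) ->
    \sum_(x <- t) h (u x) = \sum_(x <- t) h1 (u x) + \sum_(x <- t) h2 (u x).
  by move=> pu; rewrite -big_split; apply: eq_bigr => x _; exact: hE.
rewrite sumE// (eq_cvg _ _ (fun n => sumE _ (s n) _ (@pval n))).
exact: cvgD.
Qed.

Lemma approx_pairings k r (l : seq (nat * formula)) (e : R) :
  (\forall n \near \oo, (size (s n) <= k)%N) -> r \in sL -> 0 < e ->
  (forall x, x \in l -> fv_lt x.1 x.2) ->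
  \forall n \near \oo, exists v : V n, forall x, x \in l ->
    `|val v x.1 x.2 - valL r x.1 x.2| < e.
Proof.
move=> sk rs e0 fl; set c := fun x : nat * formula => valL r x.1 x.2.
(* The successor keeps [m] positive when [l] is empty; [m] bounds [F] since every squared difference
   is at most 1. *)
pose m : R := (size l).+1%:R; have m0 : 0 < m by rewrite ltr0n.
pose F (u : nat -> formula -> R) := \sum_(x <- l) (u x.1 x.2 - c x) ^+ 2.
pose h u := 1 - m^-1 * F u.
have F_ge x u : x \in l -> (u x.1 x.2 - c x) ^+ 2 <= F u.
  move=> xl; rewrite /F (big_rem x)//= lerDl sumr_ge0// => ? _; exact: sqr_ge0.
have F0 u : 0 <= F u by apply: sumr_ge0 => ? _; exact: sqr_ge0.
have Fm u : is_pairing u -> F u <= m.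
  move=> pu; apply: (@le_trans _ _ (\sum_(x <- l) 1)).
    rewrite /F big_seq [leRHS]big_seq; apply: ler_sum => x xl.
    have /andP[u0 u1] := pairing_itv pu (fl _ xl).
    have /andP[c0 c1] := pairing_itv (pvalL r) (fl _ xl).
    rewrite /c; nra.
  by rewrite big_const_seq count_predT iter_addr_0 ler_nat.
have ph : pairing_poly h.
  apply: pairing_polyD; first exact: pairing_poly_cst.
  under eq_fun do rewrite -mulNr.
  apply: pairing_polyM; first exact: pairing_poly_cst.
  apply: pairing_poly_sum => x xl; apply: pairing_polyX.
  by apply: pairing_polyD; [exact/pairing_poly_val/fl|exact: pairing_poly_cst].
have h01 u : is_pairing u -> 0 <= h u <= 1.
  move=> pu; rewrite /h subr_ge0 lerBlDr lerDl mulr_ge0 ?invr_ge0 ?(ltW m0)//.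
  by rewrite andbT mulrC ler_pdivrMr// mul1r Fm.
(* The maximum with 0 keeps the base of the powers nonnegative even if [e ^+ 2] exceeds [m]. *)
pose d := Num.max 0 (1 - m^-1 * e ^+ 2).
have d0 : 0 <= d by rewrite le_max lexx.
have d1 : d < 1 by rewrite gt_max ltr01 ltrBlDr ltrDl mulr_gt0 ?invr_gt0// exprn_gt0.
(* The value 1/2 separates the limit of the sums, which is at least 1, from the bound that holds
   when no vertex is close to [r]. *)
have [a ka] : exists a, k%:R * d ^+ a < 2^-1.
  have : (fun a => k%:R * d ^+ a) @ \oo --> k%:R * (0 : R).
    by apply: cvgMr; apply: cvg_expr; rewrite ger0_norm.
  by rewrite mulr0 => /cvgr_lt/(_ 2^-1)[]; [rewrite invr_gt0|move=> a _ /(_ a (leqnn a)); exists a].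
have hr : h (valL r) = 1.
  by rewrite /h /F big1 ?mulr0 ?subr0// => x _; rewrite /c subrr expr0n.
have lim1 : 1 <= \sum_(w <- sL) h (valL w) ^+ a.
  rewrite (big_rem r)//= hr expr1n lerDl sumr_ge0// => w _.
  by rewrite exprn_ge0//; case/andP: (h01 _ (pvalL w)).
have /cvgr_gt/(_ 2^-1) := cvg_pairing_poly (pairing_polyX a ph).
rewrite (lt_le_trans _ lim1) ?invf_lt1 ?ltr1n// => /(_ isT) sum_gt.
near=> n; apply: contrapT => bad.
have : \sum_(v <- s n) h (val v) ^+ a <= k%:R * d ^+ a.
  apply: (@le_trans _ _ (\sum_(v <- s n) d ^+ a)).
    apply: ler_sum => v _; have /andP[h0 _] := h01 _ (pval v).
    apply: lerXn2r => //; rewrite le_max; apply/orP; right.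
    (* A vertex that is not close misses some [x] in [l] by at least [e], which forces [F] to be at
       least [e ^+ 2]. *)
    move/forallNP : bad => /(_ v) /existsNP[x] /not_implyP[xl] /negP.
    rewrite -leNgt => ex; rewrite /h lerB// ler_pM2l ?invr_gt0//.
    apply: le_trans (F_ge x _ xl).
    by rewrite -[leRHS]real_normK ?num_real// lerXn2r// ?nnegrE// ltW.
  rewrite big_const_seq count_predT iter_addr_0 -[leLHS]mulr_natl ler_wpM2r ?exprn_ge0// ler_nat.
  by near: n.
by apply/negP; rewrite -ltNge (lt_trans ka)//; near: n.
Unshelve. all: by end_near.
Qed.
End approximation.

(** * Choosing the roots *)

(** For each [n], take a witness of the largest level [M <= n] that is satisfiable at [n]; level 0
    ensures there is one. Any fixed [m] is eventually a candidate, so [M >= m] from then on. As [Q]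
    is not assumed monotone in the level, the conclusion keeps [M]. *)
Lemma diagonal_choice (V : nat -> Type) (Q : forall n, nat -> V n -> Prop) :
  (forall n, exists v, Q n 0 v) ->
  (forall m, \forall n \near \oo, exists v, Q n m v) ->
  exists v : forall n, V n,
    forall m, \forall n \near \oo, exists2 M, (m <= M)%N & Q n M (v n).
Proof.
move=> Q0 Qm.
have H n : exists v M, [/\ Q n M v, (M <= n)%N &
    forall m, (m <= n)%N -> (exists u, Q n m u) -> (m <= M)%N].
  pose b m := (m <= n)%N && `[< exists u, Q n m u >].
  have b0 : exists m, b m by exists 0%N; apply/asboolP; exact: Q0.
  have bn m : b m -> (m <= n)%N by case/andP.
  have [M /andP[Mn /asboolP[v QM]] Mmax] := ex_maxnP b0 bn.
  exists v, M; split=> // m mn Qnm; apply: Mmax.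
  by rewrite /b mn; apply/asboolP.
exists (fun n => projT1 (cid (H n))) => m; near=> n.
have [M [QM Mn Mmax]] := projT2 (cid (H n)); exists M => //.
by apply: Mmax; near: n; [exact: nbhs_infty_ge|exact: Qm].
Unshelve. all: by end_near.
Qed.

Section limit.
Variables (R : realType) (V : nat -> Type) (W : eqType).
Variables (s : forall n, seq (V n)) (val : forall n, V n -> nat -> formula -> R).
Variables (sL : seq W) (valL : W -> nat -> formula -> R).
Hypothesis pval : forall n v, is_pairing (@val n v).
Hypothesis pvalL : forall w, is_pairing (valL w).
Hypothesis cvg_val : forall p f, fv_lt p f ->
  (fun n => \sum_(v <- s n) val v p f) @ \oo --> \sum_(w <- sL) valL w p f.

Lemma cvg_pairing_root k r : (forall n, inhabited (V n)) ->
  (\forall n \near \oo, (size (s n) <= k)%N) -> r \in sL ->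
  exists v : forall n, V n, forall p f, fv_lt p f ->
    (fun n => val (v n) p f) @ \oo --> valL r p f.
Proof.
move=> V0 sk rs.
(* Level [m] tests the well-formed pairs among the first [m] codes, with tolerance [m.+1%:R^-1];
   level 0 is vacuous. *)
pose l m := [seq x : nat * formula <- pmap unpickle (iota 0 m) | fv_lt x.1 x.2].
have [n|m|v vQ] := @diagonal_choice V (fun n m u => forall x, x \in l m ->
    `|val u x.1 x.2 - valL r x.1 x.2| < m.+1%:R^-1).
- by have [u] := V0 n; exists u.
- apply: (approx_pairings pval pvalL cvg_val sk rs); first by rewrite invr_gt0 ltr0n.
  by move=> x; rewrite mem_filter => /andP[].
exists v => p f fp; apply/cvgrPdist_lt => e e0.
have [m me] : exists m : nat, m.+1%:R^-1 < e.
  by have [m _ /(_ m (leqnn m)) me] := near_infty_natSinv_lt (PosNum e0); exists m.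
pose i := pickle (p, f).
(* Beyond level [m] the tolerance is below [e], and beyond level [i.+1] the pair [(p, f)] is among
   those tested. *)
have := vQ (maxn m i.+1); apply: filterS => n [M Mge QM].
rewrite distrC; apply: lt_trans (le_lt_trans _ me).
  apply: QM (p, f) _.
  rewrite mem_filter fp /= mem_pmap; apply/mapP; exists i; last by rewrite pickleK.
  by rewrite mem_iota /= (leq_trans _ Mge)// leq_max leqnn orbT.
rewrite lef_pV2 ?posrE ?ltr0n// ler_nat ltnS.
by rewrite (leq_trans _ Mge)// leq_max leqnn.
Qed.
End limit.

(** * Application to rooted finite graphs and modelings *)

Lemma is_pairing_fin (R : realType) (G : fin_graph) (v : G) :
  is_pairing (fun p f => stone_fin G (Some v) p f : R).
Proof.
split=> [|p f _|p q f g].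
- by rewrite stone_fin_sentence asboolT.
- exact: stone_fin_itv.
- exact: stone_fin_indep_and.
Qed.

Lemma is_pairing_mod d (T : measurableType d) (R : realType) (P : probability T R)
    (E : T -> T -> Prop) (v : T) :
  (forall p f, rootless f -> fv_lt p f -> measurable (defset E None p f)) ->
  is_pairing (fun p f => fine (stone_mod P E (Some v) p f)).
Proof.
move=> mE; split=> [|p f fp|p q f g].
- by rewrite /stone_mod /= indicE mem_set.
- by apply: stone_mod_itv; exact: measurable_defset_root.
- exact: stone_mod_indep_and.
Qed.

Unset Implicit Arguments. Set Strict Implicit.

Theorem theorem2 (R : realType) (G : nat -> fin_graph)
    (d : measure_display) (T : measurableType d) (P : probability T R)
    (E : T -> T -> Prop) (xi : formula) :
  FO_convergent R G ->
  modeling_limit G P E ->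
  rootless xi -> fv_lt 1 xi ->
  finite_set [set x : T | sat E None (upd (fun _ => None) 0 x) xi] ->
  [set x : T | sat E None (upd (fun _ => None) 0 x) xi] !=set0 ->
  exists (rn : forall n, fvert (G n)) (r : T),
    sat E None (upd (fun _ => None) 0 r) xi /\
    forall (p : nat) (f : formula), fv_lt p f ->
      (fun n => (stone_fin (G n) (Some (rn n)) p f)%:E) @ \oo
        --> stone_mod P E (Some r) p f.
Proof.
move=> _ [[_ _ _ mE] GL] rxi xi1 /finite_seqP[s0 xiE] [r rxiL].
pose sL := undup s0.
have usL : uniq sL by exact: undup_uniq.
have sLP x : x \in sL <-> sat E None (upd (fun=> None) 0 x) xi.
  rewrite mem_undup; have := congr1 (fun A : set T => A x) xiE => /= xE.
  by rewrite xE.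
pose k := size sL.
pose s n := [seq v <- enum (G n) |
  `[< sat (fun x y => fedge x y) None (upd (fun=> None) 0 v) xi >]].
have us n : uniq (s n) by apply: filter_uniq; exact: enum_uniq.
have sP n x : x \in s n <->
    sat (fun x y => fedge x y) None (upd (fun=> None) 0 x) xi.
  by rewrite mem_filter mem_enum andbT; split=> /asboolP.
(* Having at least [k.+1] solutions of [xi] is a sentence, false in the modeling. Its pairings with
   the [G n] are 0 or 1 and tend to 0, so they eventually vanish. *)
have sk : \forall n \near \oo, (size (s n) <= k)%N.
  pose f := count_formula xi 0 k.+1 ftop.
  have rf : rootless f by exact: rootless_count.
  have f0 : fv_lt 0 f by exact: fv_lt_count.
  have fL : stone_mod P E None 0 f = 0%E.
    rewrite /stone_mod /= indicE memNset// => /(sat_count _ _ xi1 _ usL sLP).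
    by rewrite ltnNge count_size => /(_ isT).
  have := GL 0%N f rf f0; rewrite fL => /fine_cvg/cvgr_lt/(_ 1 ltr01).
  apply: filterS => n /=; rewrite stone_fin_sentence.
  case: asboolP => [|nf _]; first by rewrite ltxx.
  rewrite leqNgt; apply/negP => kn; apply: nf.
  apply/(@sat_count _ _ xi 0 k.+1 ftop [::] (s n) xi1 isT (us n) (sP n)).
  by rewrite (eq_count (a2 := predT)) ?count_predT// => x; apply/asboolP.
have cvg_val p f : fv_lt p f ->
    (fun n => \sum_(v <- s n) stone_fin (G n) (Some v) p f) @ \oo -->
    \sum_(w <- sL) fine (stone_mod P E (Some w) p f).
  move=> fp; rewrite (stone_mod_count P mE (leqnn _) rxi xi1 fp usL sLP).
  (* The sum over [s n] equals the sum of [k] unrooted pairings only once [size (s n) <= k], hence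
     for all large [n]. *)
  apply: (@cvg_trans _ ((fun n => \sum_(j < k)
      (stone_fin (G n) None p (count_formula xi p j.+1 f) : R)) @ \oo)).
    apply: near_eq_cvg; near=> n.
    by apply/esym/stone_fin_count => //; near: n.
  apply: cvg_big => [|j _]; first exact: add_continuous.
  apply: (@fine_cvg _ _ _ _ (EFin \o _)) => /=.
  have rj := rootless_count p j.+1 f rxi.
  have fj := fv_lt_count j.+1 xi1 fp.
  by rewrite fineK; [exact: GL|apply: stone_mod_fin_num; exact: mE].
have rsL : r \in sL by exact/sLP.
have [|rn rnP] := cvg_pairing_root (fun n => @is_pairing_fin R (G n))
  (fun v => is_pairing_mod P v mE) cvg_val _ sk rsL.
  (* Nonempty vertex sets supply a root for those early [n] where no closeness to [r] is
     available. *)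
  move=> n; have /card_gt0P[x _] := fvert_ne (G n); exact: (inhabits x).
exists rn, r; split=> // p f fp.
rewrite -(fineK (stone_mod_fin_num P (measurable_defset_root mE r fp))).
by apply: cvg_EFin; [exact: nearW|exact: rnP].
Unshelve. all: by end_near.
Qed.
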